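(* Let $X$ be a two-parameter Lévy process on $\mathbb{R}^d$ with exponent $\psi$ and let $\alpha(t)=(x(t),y(t))_{t\in T}$ be a decreasing path. Then for any $n\ge1$ and $t_1<\cdots<t_n$ in $T$, the characteristic function $\phi_{t_1,\ldots,t_n}$ of the $\mathbb{R}^{nd}$-valued random variable $(X_{x(t_k),y(t_k)})_{k=1,\ldots,n}$ is given, for $z=(z_k)_{k=1,\ldots,n}$ with $z_k\in\mathbb{R}^d$, by $$\phi_{t_1,\ldots,t_n}(z)=\exp\Bigg[\sum_{i=1}^n\sum_{j=1}^{n-i+1}(x(t_i)-x(t_{i-1}))(y(t_{i+j-1})-y(t_{i+j}))\,\psi\Big(\sum_{k=i}^{i+j-1}z_k\Big)\Bigg],$$ with the convention $x(t_0)=y(t_{n+1})=0$.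
   Context: For $s,t\in\mathbb{R}_+^2$ with $s_1\le t_1$, $s_2\le t_2$, the rectangle $(s,t]$ is $(s_1,t_1]\times(s_2,t_2]$, and the increment of $X$ over it is $X((s,t])=X_{t_1,t_2}-X_{s_1,t_2}-X_{t_1,s_2}+X_{s_1,s_2}$. A two-parameter Lévy process on $\mathbb{R}^d$ is an $\mathbb{R}^d$-valued process $X=\{X_t:t\in\mathbb{R}_+^2\}$ such that: increments over finitely many disjoint rectangles are independent; $X(B)$ and $X(B+p)$ have the same law for every rectangle $B$ and $p\in\mathbb{R}_+^2$; $X$ vanishes on the axes a.s.; $X$ is continuous in probability; and its sample paths are a.s. right continuous with quadrantal limits. Its exponent is the unique Lévy–Khintchine exponent $\psi$ with $E[e^{i\langle z,X(B)\rangle}]=e^{m(B)\psi(z)}$ for every rectangle $B$, $m$ Lebesgue measure. $T\subseteq\mathbb{R}$ is an interval with interior $T^\circ$. A decreasing path is $\alpha(t)=(x(t),y(t))_{t\in T}$ with $x$ nondecreasing and $y$ nonincreasing continuous functions on $T$, both strictly positive on $T^\circ$, at least one not identically constant. *)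

(* Defs.v *)
From mathcomp Require Import all_boot all_order all_algebra all_classical all_reals all_analysis.
Import numFieldNormedType.Exports.
Import Order.TTheory GRing.Theory Num.Theory.
Set Implicit Arguments. Unset Strict Implicit. Unset Printing Implicit Defensive.
Local Open Scope classical_set_scope.
Local Open Scope ring_scope.

Section Defs.
Variable R : realType.

Definition borel_rV (d : nat) : set (set 'rV[R]_d) := <<s open >>.

Definition dotv (d : nat) (u v : 'rV[R]_d) : R := \sum_(i < d) u 0 i * v 0 i.

Definition rect (s1 s2 t1 t2 : R) : set (R * R) :=
  [set p | s1 < p.1 <= t1 /\ s2 < p.2 <= t2].

Definition incr (Om : Type) (d : nat) (X : R -> R -> Om -> 'rV[R]_d)
  (s1 s2 t1 t2 : R) (w : Om) : 'rV[R]_d :=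
  X t1 t2 w - X s1 t2 w - X t1 s2 w + X s1 s2 w.

Definition quad_lim (d : nat) (f : R -> R -> 'rV[R]_d) (Q : R -> R -> Prop)
  (t1 t2 : R) (L : 'rV[R]_d) : Prop :=
  forall e : R, 0 < e -> exists2 del : R, 0 < del &
    forall s1 s2 : R, 0 <= s1 -> 0 <= s2 -> Q s1 s2 -> (s1, s2) <> (t1, t2) ->
      `|s1 - t1| < del -> `|s2 - t2| < del -> `|f s1 s2 - L| < e.

Definition rcql (d : nat) (f : R -> R -> 'rV[R]_d) : Prop :=
  forall t1 t2 : R, 0 <= t1 -> 0 <= t2 ->
    quad_lim f (fun s1 s2 => t1 <= s1 /\ t2 <= s2) t1 t2 (f t1 t2) /\
    (exists L, quad_lim f (fun s1 s2 => s1 < t1 /\ t2 <= s2) t1 t2 L) /\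
    (exists L, quad_lim f (fun s1 s2 => t1 <= s1 /\ s2 < t2) t1 t2 L) /\
    (exists L, quad_lim f (fun s1 s2 => s1 < t1 /\ s2 < t2) t1 t2 L).

Definition two_param_levy (dO : measure_display) (Om : measurableType dO)
  (P : probability Om R) (d : nat) (X : R -> R -> Om -> 'rV[R]_d) : Prop :=
  (forall t1 t2 (A : set 'rV[R]_d), borel_rV A -> measurable (X t1 t2 @^-1` A)) /\
  (forall (k : nat) (s1 s2 t1 t2 : 'I_k -> R),
     (forall i, 0 <= s1 i <= t1 i /\ 0 <= s2 i <= t2 i) ->
     (forall i j, i != j ->
        rect (s1 i) (s2 i) (t1 i) (t2 i) `&` rect (s1 j) (s2 j) (t1 j) (t2 j) = set0) ->
     forall A : 'I_k -> set 'rV[R]_d, (forall i, borel_rV (A i)) ->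
       P (\bigcap_(i in [set: 'I_k])
            (incr X (s1 i) (s2 i) (t1 i) (t2 i) @^-1` A i)) =
       (\prod_(i < k) P (incr X (s1 i) (s2 i) (t1 i) (t2 i) @^-1` A i))%E) /\
  (forall s1 s2 t1 t2 p1 p2 : R, 0 <= s1 <= t1 -> 0 <= s2 <= t2 ->
     0 <= p1 -> 0 <= p2 ->
     forall A : set 'rV[R]_d, borel_rV A ->
       P (incr X s1 s2 t1 t2 @^-1` A) =
       P (incr X (s1 + p1) (s2 + p2) (t1 + p1) (t2 + p2) @^-1` A)) /\
  {ae P, forall w, forall t : R, 0 <= t -> X 0 t w = 0 /\ X t 0 w = 0} /\
  (forall t1 t2 : R, 0 <= t1 -> 0 <= t2 -> forall e eta : R, 0 < e -> 0 < eta ->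
     exists2 del : R, 0 < del & forall s1 s2 : R, 0 <= s1 -> 0 <= s2 ->
       `|s1 - t1| < del -> `|s2 - t2| < del ->
       (P [set w | (e < `|X s1 s2 w - X t1 t2 w|)%R ] < eta%:E)%E) /\
  {ae P, forall w, rcql (fun s1 s2 => X s1 s2 w)}.

(* psi = psi_re + i psi_im is the exponent of X:
   E[exp(i<z,X(B)>)] = exp(m(B) psi(z)) for every rectangle B = (s,t],
   written out in real and imaginary parts. *)
Definition levy_exponent (dO : measure_display) (Om : measurableType dO)
  (P : probability Om R) (d : nat) (X : R -> R -> Om -> 'rV[R]_d)
  (psi_re psi_im : 'rV[R]_d -> R) : Prop :=
  forall (s1 s2 t1 t2 : R) (z : 'rV[R]_d), 0 <= s1 <= t1 -> 0 <= s2 <= t2 ->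
    let m := (t1 - s1) * (t2 - s2) in
    (\int[P]_w (cos (dotv z (incr X s1 s2 t1 t2 w)))%:E =
       (expR (m * psi_re z) * cos (m * psi_im z))%:E)%E /\
    (\int[P]_w (sin (dotv z (incr X s1 s2 t1 t2 w)))%:E =
       (expR (m * psi_re z) * sin (m * psi_im z))%:E)%E.

Definition decreasing_path (T : set R) (x y : R -> R) : Prop :=
  {in T &, {homo x : a b / a <= b}} /\
  {in T &, {homo y : a b / a <= b >-> b <= a}} /\
  {within T, continuous x} /\ {within T, continuous y} /\
  (forall t, (interior T) t -> 0 < x t /\ 0 < y t) /\
  ((exists a b, T a /\ T b /\ x a != x b) \/ (exists a b, T a /\ T b /\ y a != y b)).

End Defs.

(* Main.v *)
(** Put x_0 = y_(n+1) = 0. The points (x_k, y_k) generate a grid of pairwise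
    disjoint rectangles R_il = (x_(i-1), x_i] x (y_(l+1), y_l], and since X
    vanishes on the axes, X at (x_k, y_k) is almost surely the sum of the
    increments X(R_il) over i <= k <= l. Exchanging sums, the linear form
    sum_k <z_k, X_k> becomes the sum over i <= l of
    <z_i + ... + z_l, X(R_il)>. The increments are independent, so the
    characteristic function is the product of the exp(m(R_il) psi(...)). *)
Require Import Defs.
From mathcomp Require Import all_boot all_order all_algebra all_classical all_reals all_analysis.
From mathcomp Require Import measurable_realfun ring lra zify.
Import numFieldNormedType.Exports.
Import Order.TTheory GRing.Theory Num.Theory.
Set Implicit Arguments. Unset Strict Implicit. Unset Printing Implicit Defensive.
Local Open Scope classical_set_scope.
Local Open Scope ring_scope.

(** * Expectations of bounded measurable functions *)

Section BoundedMeasurable.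
Context (R : realType) (dO : measure_display) (Om : measurableType dO).
Implicit Types f g : Om -> R.

(** Boundedness, unlike integrability, is stable under products, and for the probability [P] it
    implies integrability, so linearity of the expectation costs no further side condition. *)
Definition bounded_measurable f :=
  measurable_fun setT f /\ exists M, forall w, `|f w| <= M.

Lemma bounded_measurableD f g : bounded_measurable f -> bounded_measurable g ->
  bounded_measurable (fun w => f w + g w).
Proof.
move=> [mf [M fM]] [mg [N gN]]; split; first exact: measurable_funD.
by exists (M + N) => w; rewrite (le_trans (ler_normD _ _))// lerD.
Qed.

Lemma bounded_measurableB f g : bounded_measurable f -> bounded_measurable g ->
  bounded_measurable (fun w => f w - g w).
Proof.
move=> [mf [M fM]] [mg [N gN]]; split; first exact: measurable_funB.
by exists (M + N) => w; rewrite (le_trans (ler_normB _ _))// lerD.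
Qed.

Lemma bounded_measurableM f g : bounded_measurable f -> bounded_measurable g ->
  bounded_measurable (fun w => f w * g w).
Proof.
move=> [mf [M fM]] [mg [N gN]]; split; first exact: measurable_funM.
by exists (M * N) => w; rewrite normrM ler_pM.
Qed.

Lemma bounded_measurable_cst (c : R) : bounded_measurable (fun=> c).
Proof. by split; [exact: measurable_cst|exists `|c|]. Qed.

Lemma bounded_measurable_indic (A : set Om) :
  measurable A -> bounded_measurable (\1_A : Om -> R).
Proof.
move=> mA; split; first exact: measurable_indic.
by exists 1 => w; rewrite indicE; case: (_ \in _); rewrite ?normr1 ?normr0.
Qed.

Lemma bounded_measurable_sum (I : Type) (s : seq I) (F : I -> Om -> R) :
  (forall i, bounded_measurable (F i)) ->
  bounded_measurable (fun w => \sum_(i <- s) F i w).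
Proof.
move=> bF; elim: s => [|i s IHs].
  by under eq_fun do rewrite big_nil; exact: bounded_measurable_cst.
by under eq_fun do rewrite big_cons; exact: bounded_measurableD.
Qed.

Lemma bounded_measurable_cos f : measurable_fun setT f ->
  bounded_measurable (fun w => cos (f w)).
Proof.
move=> mf; split; last by exists 1 => w; exact: cos_max.
apply: measurableT_comp mf; apply: continuous_measurable_fun.
exact: continuous_cos.
Qed.

Lemma bounded_measurable_sin f : measurable_fun setT f ->
  bounded_measurable (fun w => sin (f w)).
Proof.
move=> mf; split; last by exists 1 => w; exact: sin_max.
apply: measurableT_comp mf; apply: continuous_measurable_fun.
exact: continuous_sin.
Qed.

Variable P : probability Om R.

Lemma bounded_measurable_integrable f :
  bounded_measurable f -> P.-integrable setT (EFin \o f).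
Proof.
move=> [mf [M fM]]; apply: measurable_bounded_integrable => //.
  by apply: le_lt_trans (probability_le1 P measurableT) _; rewrite ltry.
exists M; split; first exact: num_real.
by move=> x Mx w _; exact: le_trans (fM w) (ltW Mx).
Qed.

Lemma EFin_Rintegral f : bounded_measurable f ->
  (\int[P]_w (f w)%:E = (\int[P]_w f w)%R%:E)%E.
Proof.
by move=> /bounded_measurable_integrable fi; rewrite fineK// integrable_fin_num.
Qed.

Lemma Rintegral_boundedD f g : bounded_measurable f -> bounded_measurable g ->
  \int[P]_w (f w + g w) = \int[P]_w f w + \int[P]_w g w.
Proof. by move=> bf bg; rewrite RintegralD//; exact: bounded_measurable_integrable. Qed.

Lemma Rintegral_boundedB f g : bounded_measurable f -> bounded_measurable g ->
  \int[P]_w (f w - g w) = \int[P]_w f w - \int[P]_w g w.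
Proof. by move=> bf bg; rewrite RintegralB//; exact: bounded_measurable_integrable. Qed.

Lemma Rintegral_boundedZ (c : R) f : bounded_measurable f ->
  \int[P]_w (c * f w) = c * \int[P]_w f w.
Proof. by move=> bf; rewrite RintegralZl//; exact: bounded_measurable_integrable. Qed.

Lemma Rintegral_bounded_sum (I : Type) (s : seq I) (F : I -> Om -> R) :
  (forall i, bounded_measurable (F i)) ->
  \int[P]_w (\sum_(i <- s) F i w) = \sum_(i <- s) \int[P]_w F i w.
Proof.
move=> bF; elim: s => [|i s IHs].
  rewrite big_nil; under eq_Rintegral do rewrite big_nil.
  by rewrite Rintegral_cst// mul0r.
rewrite big_cons; under eq_Rintegral do rewrite big_cons.
by rewrite Rintegral_boundedD// ?IHs//; exact: bounded_measurable_sum.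
Qed.

(** Dominated convergence with the constant [M] as dominating function, integrable since [P] is
    finite; the limit inherits the bound. *)
Lemma bounded_convergence (f_ : nat -> Om -> R) f (M : R) :
  (forall n, measurable_fun setT (f_ n)) -> measurable_fun setT f ->
  (forall n w, `|f_ n w| <= M) ->
  (forall w, f_ n w @[n --> \oo] --> f w) ->
  \int[P]_w f_ n w @[n --> \oo] --> \int[P]_w f w.
Proof.
move=> mf_ mf fM cf.
have fM' w : `|f w| <= M.
  have /cvg_norm c := cf w.
  by rewrite -(cvg_lim _ c)//; apply: limr_le; [exact: cvgP c|exact: nearW].
have [|||||_ _] := @dominated_convergence _ _ _ P setT measurableT
  (fun n => EFin \o f_ n) (EFin \o f) (fun=> M%:E).
- by move=> n; exact/measurable_EFinP.
- exact/measurable_EFinP.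
- by apply: aeW => w _; apply/fine_cvgP; split; [exact: nearW|exact: cf].
- by apply: bounded_measurable_integrable; exact: bounded_measurable_cst.
- by apply: aeW => w n _; rewrite /= lee_fin.
rewrite [X in _ --> X](@EFin_Rintegral f); last by split => //; exists M.
exact: fine_cvg.
Qed.

End BoundedMeasurable.

(** * Characteristic function of a sum of independent variables *)

Section Independence.
Context (R : realType) (dO : measure_display) (Om : measurableType dO).
Variable P : probability Om R.

Import HBNNSimple.

(* The identity is linear in f and stable under bounded monotone limits, so it
   passes from indicators to simple functions and then to bounded functions. *)
Lemma Rintegral_mul_comp (G U : Om -> R) (c : R) :
  bounded_measurable G -> measurable_fun setT U ->
  (forall B : set R, measurable B ->
    \int[P]_w (G w * \1_B (U w)) = c * \int[P]_w \1_B (U w)) ->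
  forall f : R -> R, bounded_measurable f ->
    \int[P]_w (G w * f (U w)) = c * \int[P]_w f (U w).
Proof.
move=> bG mU GU.
have bcomp (f : R -> R) : bounded_measurable f -> bounded_measurable (f \o U).
  move=> [mf [M fM]]; split; first exact: measurableT_comp.
  by exists M => w; exact: fM.
have bindic (B : set R) : measurable B -> bounded_measurable (fun w => \1_B (U w) : R).
  by move=> mB; apply: bcomp; exact: bounded_measurable_indic.
have simple (h : {nnsfun R >-> R}) :
    \int[P]_w (G w * h (U w)) = c * \int[P]_w h (U w).
  have bi (y : R) : bounded_measurable (fun w => \1_(h @^-1` [set y]) (U w) : R).
    by apply: bindic; exact: measurable_funPTI.
  under eq_Rintegral do rewrite fimfunEord mulr_sumr.
  under [in RHS]eq_Rintegral do rewrite fimfunEord.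
  rewrite !Rintegral_bounded_sum; last 2 first.
  - by move=> i; apply: bounded_measurableM (bi _); exact: bounded_measurable_cst.
  - move=> i; apply: bounded_measurableM => //.
    by apply: bounded_measurableM (bi _); exact: bounded_measurable_cst.
  rewrite mulr_sumr; apply: eq_bigr => i _.
  under eq_Rintegral do rewrite mulrCA.
  rewrite !Rintegral_boundedZ//; last exact: bounded_measurableM.
  by rewrite GU// 1?mulrCA//; exact: measurable_funPTI.
have nneg (f : R -> R) : (forall r, 0 <= f r) -> bounded_measurable f ->
    \int[P]_w (G w * f (U w)) = c * \int[P]_w f (U w).
  move=> f0 bf; have [mf [M fM]] := bf; have [mG [N GN]] := bG.
  have mfE : measurable_fun setT (EFin \o f) by exact/measurable_EFinP.
  pose h := nnsfun_approx measurableT mfE.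
  have hcvg r : h n r @[n --> \oo] --> f r.
    have : (EFin \o h ^~ r) @ \oo --> (f r)%:E.
      by apply: (cvg_nnsfun_approx measurableT mfE) => // x _; rewrite /= lee_fin.
    exact: fine_cvg.
  (* The approximants increase to [f], hence stay below its bound; this is the uniform bound that
     both limits below need. *)
  have hM n r : `|h n r| <= M.
    rewrite ger0_norm//; apply: le_trans (fM r).
    rewrite ger0_norm// -(cvg_lim _ (hcvg r))//.
    apply: (@nondecreasing_cvgn_le _ (h ^~ r)); last exact: cvgP (hcvg r).
    by move=> m k mk; exact/lefP/nd_nnsfun_approx.
  have mh n : measurable_fun setT (h n \o U) by exact: measurableT_comp.
  have c1 : \int[P]_w (G w * h n (U w)) @[n --> \oo] --> \int[P]_w (G w * f (U w)).
    apply: (bounded_convergence (M := N * M)).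
    - by move=> n; exact: measurable_funM mG (mh n).
    - exact: measurable_funM mG (measurableT_comp mf mU).
    - by move=> n w; rewrite normrM ler_pM.
    - by move=> w; apply: cvgMr; exact: hcvg.
  have c2 : c * \int[P]_w h n (U w) @[n --> \oo] --> c * \int[P]_w f (U w).
    apply: cvgMr; apply: (bounded_convergence (M := M)) => //.
    exact: measurableT_comp mf mU.
  move: c1; under eq_fun do rewrite simple; move=> c1.
  exact: cvg_unique c1 c2.
move=> f bf; have [_ [M fM]] := bf.
(* Adding the bound [M] makes [f] nonnegative, and the constant [M] is nonnegative too, so both
   terms of the difference fall under [nneg]. *)
have fE r : f r = (f r + M) - M by rewrite addrK.
have bM : bounded_measurable (fun _ : R => M) by exact: bounded_measurable_cst.
have bfM : bounded_measurable (fun r => f r + M) by exact: bounded_measurableD.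
have M0 : 0 <= M by exact: le_trans (fM 0).
have fM0 r : 0 <= f r + M by have := fM r; rewrite ler_norml => /andP[]; lra.
under eq_Rintegral do rewrite fE mulrBr.
under [in RHS]eq_Rintegral do rewrite fE.
rewrite !Rintegral_boundedB; last 4 first.
- exact: bcomp bfM.
- exact: bcomp bM.
- exact: bounded_measurableM bG (bcomp _ bfM).
- exact: bounded_measurableM bG (bcomp _ bM).
rewrite (nneg _ fM0 bfM) (nneg (fun=> M))//.
by rewrite mulrBr.
Qed.

Variables (I : finType) (U : I -> Om -> R).
Hypothesis mU : forall i, measurable_fun setT (U i).
Hypothesis indepU : forall B : I -> set R, (forall i, measurable (B i)) ->
  P (\bigcap_(i in [set: I]) (U i @^-1` B i)) = (\prod_i P (U i @^-1` B i))%E.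
(** The characteristic function of [U i] at 1 is exp(a_i + i b_i), split into real and imaginary
    parts. *)
Variables (a b : I -> R).
Hypothesis cosU : forall i, \int[P]_w cos (U i w) = expR (a i) * cos (b i).
Hypothesis sinU : forall i, \int[P]_w sin (U i w) = expR (a i) * sin (b i).

(* Restricting the expectation to the events U_i in B_i, for i not in s, is what
   lets each inductive step apply Rintegral_mul_comp to the next variable. *)
Lemma charfun_sum_indic (s : seq I) : uniq s ->
  forall B : I -> set R, (forall i, measurable (B i)) ->
  (forall i, i \in s -> B i = setT) ->
  let D := \bigcap_(i in [set: I]) (U i @^-1` B i) in
  let A := expR (\sum_(i <- s) a i) in
  let b_ := \sum_(i <- s) b i in
  let p := \prod_i fine (P (U i @^-1` B i)) in
  \int[P]_w (cos (\sum_(i <- s) U i w) * \1_D w) = A * cos b_ * p /\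
  \int[P]_w (sin (\sum_(i <- s) U i w) * \1_D w) = A * sin b_ * p.
Proof.
have fP A : measurable A -> (fine (P A))%:E = P A.
  by move=> mA; rewrite fineK// fin_num_measure.
have mUB i (B : set R) : measurable B -> measurable (U i @^-1` B).
  by move=> mB; rewrite -[X in measurable X]setTI; exact: mU.
have mcap (B : I -> set R) : (forall i, measurable (B i)) ->
    measurable (\bigcap_(i in [set: I]) (U i @^-1` B i)).
  by move=> mB; apply: fin_bigcap_measurable => // i _; exact: mUB.
have Eindic A : measurable A -> \int[P]_w \1_A w = fine (P A).
  by move=> mA; rewrite /Rintegral integral_indic// setIT.
elim: s => [_|j s IHs us0] B mB BT D A b_ p.
  (* With no summand the cosine is 1 and the sine 0, and independence gives the probability of [D]
     as a product. *)
  rewrite /A /b_ !big_nil expR0 cos0 sin0 mul1r mulr0 mul0r mul1r.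
  under eq_Rintegral do rewrite big_nil cos0 mul1r.
  under [X in _ /\ X = _]eq_Rintegral do rewrite big_nil sin0 mul0r.
  rewrite Eindic ?Rintegral_cst ?mul0r//; last exact: mcap.
  split=> //; apply: EFin_inj; rewrite fP; last exact: mcap.
  by rewrite indepU// -prodEFin; apply: eq_bigr => i _; rewrite fP//; exact: mUB.
have /andP[js us] : (j \notin s) && uniq s := us0.
have mS : measurable_fun setT (fun w => \sum_(i <- s) U i w) by exact: measurable_sum.
have bD : bounded_measurable (\1_D : Om -> R).
  by apply: bounded_measurable_indic; exact: mcap.
have Bj : B j = setT by rewrite BT// mem_head.
have step (G : Om -> R) (g : R) : bounded_measurable G ->
    (forall B : I -> set R, (forall i, measurable (B i)) ->
     (forall i, i \in s -> B i = setT) ->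
     \int[P]_w (G w * \1_(\bigcap_(i in [set: I]) (U i @^-1` B i)) w) =
     g * \prod_i fine (P (U i @^-1` B i))) ->
    forall f : R -> R, bounded_measurable f ->
    \int[P]_w (G w * \1_D w * f (U j w)) = g * p * \int[P]_w f (U j w).
  move=> bG GB; apply: Rintegral_mul_comp => //; first exact: bounded_measurableM.
  (* Since [B j] is the whole line, putting [C] there intersects [D] with the event that [U j] lies
     in [C]. As [j] is not in [s], the hypothesis on [G] still applies to [B']. *)
  move=> C mC; pose B' i := if i == j then C else B i.
  have mB' i : measurable (B' i) by rewrite /B'; case: ifP.
  transitivity (g * \prod_i fine (P (U i @^-1` B' i))); last first.
    rewrite /p (bigD1 j)//= [in RHS](bigD1 j)//= /B' eqxx Bj preimage_setT.
    rewrite probability_setT mul1r (Eindic (U j @^-1` C)); last exact: mUB.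
    rewrite mulrAC -mulrA; congr (_ * (_ * _)).
    by apply: eq_bigr => i /negbTE ->.
  rewrite -GB//; last first.
    move=> i si; rewrite /B'; case: eqVneq => [ij|_]; first by rewrite -ij si in js.
    by rewrite BT// inE si orbT.
  apply: eq_Rintegral => w _; rewrite -mulrA; congr (_ * _).
  rewrite !indicE -natrM mulnb; congr (_%:R); congr nat_of_bool.
  apply/andP/idP => [[]|]; rewrite !inE.
    move=> Dw Cw i _; rewrite /B' /=; case: eqVneq => [->//|_]; exact: Dw.
  move=> Dw; split; last by have := Dw j Logic.I; rewrite /B' /= eqxx.
  by move=> i _; have := Dw i Logic.I; rewrite /B' /=; case: eqVneq => [->|//]; rewrite Bj.
have bcos : bounded_measurable (@cos R) by exact: (bounded_measurable_cos (@measurable_id _ _ _)).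
have bsin : bounded_measurable (@sin R) by exact: (bounded_measurable_sin (@measurable_id _ _ _)).
have bc := bounded_measurable_cos mS; have bs := bounded_measurable_sin mS.
have cB B' mB' BT' := (IHs us B' mB' BT').1.
have sB B' mB' BT' := (IHs us B' mB' BT').2.
have bcU := bounded_measurable_cos (mU j); have bsU := bounded_measurable_sin (mU j).
have cc := step _ _ bc cB _ bcos; have cs := step _ _ bc cB _ bsin.
have sc := step _ _ bs sB _ bcos; have ss := step _ _ bs sB _ bsin.
(* The addition formulas split off [U j]; each of the four products factors by [step], and the
   target expands by the same formulas in [b]. *)
rewrite /A /b_ !big_cons expRD cosD sinD.
under eq_Rintegral => w _.
  rewrite big_cons addrC cosD mulrBl mulrAC (mulrAC (sin _)); over.
under [X in _ /\ X = _]eq_Rintegral => w _.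
  rewrite big_cons addrC sinD mulrDl mulrAC (mulrAC (cos _)); over.
rewrite /= Rintegral_boundedB ?Rintegral_boundedD; last 4 first.
- exact: bounded_measurableM (bounded_measurableM bs bD) bcU.
- exact: bounded_measurableM (bounded_measurableM bc bD) bsU.
- exact: bounded_measurableM (bounded_measurableM bc bD) bcU.
- exact: bounded_measurableM (bounded_measurableM bs bD) bsU.
rewrite cc ss sc cs cosU sinU; split; ring.
Qed.

(** Take every [B i] to be the whole line: the indicator and the product of probabilities are then
    1. *)
Lemma charfun_sum :
  \int[P]_w cos (\sum_i U i w) = expR (\sum_i a i) * cos (\sum_i b i) /\
  \int[P]_w sin (\sum_i U i w) = expR (\sum_i a i) * sin (\sum_i b i).
Proof.
have [//|//|hc hs] := charfun_sum_indic (index_enum_uniq I) (B := fun=> setT).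
have p1 : \prod_(i : I) fine (P (U i @^-1` setT)) = 1.
  by apply: big1 => i _; rewrite preimage_setT probability_setT.
have D1 w : \1_(\bigcap_(i in [set: I]) (U i @^-1` setT)) w = 1 :> R.
  by rewrite indicE mem_set.
rewrite p1 !mulr1 in hc hs; rewrite -hc -hs.
by split; apply: eq_Rintegral => w _; rewrite D1 mulr1.
Qed.

End Independence.

(** * Linear forms, nonnegativity of the path, disjoint rectangles *)

Section Increments.
Context (R : realType).

Lemma continuous_dotv (d : nat) (z : 'rV[R]_d) : continuous (dotv z).
Proof.
apply: continuous_big => [|i _ v]; first exact: add_continuous.
apply: cvgMr; first exact: (@nbhs_filter _ v).
exact: coord_continuous.
Qed.

(** The sets with Borel preimage under [dotv z] form a sigma-algebra, so open intervals suffice, and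
    their preimages are open by continuity. Hypotheses on Borel sets of vectors thereby pass to real
    linear forms. *)
Lemma borel_rV_dotv (d : nat) (z : 'rV[R]_d) (B : set R) :
  measurable B -> borel_rV (dotv z @^-1` B).
Proof.
have <- : (@RGenOpens.G R).-sigma.-measurable = @measurable _ R.
  by rewrite -RGenOpens.measurableE.
move=> mB; have : image_set_system setT (dotv z) (@borel_rV R d) B.
  apply: smallest_sub B mB.
    exact: (sigma_algebra_image (dotv z) (smallest_sigma_algebra setT open)).
  move=> _ [a [b ->]]; rewrite /image_set_system/= setTI; apply: sub_sigma_algebra.
  apply: open_comp => [v _|]; first exact: continuous_dotv.
  exact: interval_open.
by rewrite /image_set_system/= setTI.
Qed.

Lemma dotvDr (d : nat) (z u v : 'rV[R]_d) : dotv z (u + v) = dotv z u + dotv z v.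
Proof. by rewrite /dotv -big_split; apply: eq_bigr => i _; rewrite mxE mulrDr. Qed.

Lemma dotvNr (d : nat) (z u : 'rV[R]_d) : dotv z (- u) = - dotv z u.
Proof. by rewrite /dotv -sumrN; apply: eq_bigr => i _; rewrite mxE mulrN. Qed.

Lemma dotv_suml (d : nat) (I : Type) (s : seq I) (Q : pred I) (z : I -> 'rV[R]_d) v :
  dotv (\sum_(i <- s | Q i) z i) v = \sum_(i <- s | Q i) dotv (z i) v.
Proof.
rewrite /dotv exchange_big; apply: eq_bigr => i _.
by rewrite summxE mulr_suml.
Qed.

Lemma dotv_sumr (d : nat) (I : Type) (s : seq I) (Q : pred I) (v : I -> 'rV[R]_d) z :
  dotv z (\sum_(i <- s | Q i) v i) = \sum_(i <- s | Q i) dotv z (v i).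
Proof.
rewrite /dotv exchange_big; apply: eq_bigr => i _.
by rewrite summxE mulr_sumr.
Qed.

(** If [f t] were negative, [f] would be negative on [T] near [t]; but points strictly between [t]
    and [s] are interior to [T], and some lie arbitrarily close to [t]. *)
Lemma interval_interior_gt0_ge0 (T : set R) (f : R -> R) (s t : R) :
  is_interval T -> T s -> T t -> s != t -> {within T, continuous f} ->
  (forall u, interior T u -> 0 < f u) -> 0 <= f t.
Proof.
move=> iT Ts Tt st /subspace_continuousP/(_ _ Tt) cf f0.
rewrite leNgt; apply/negP => ft.
have /cvgrPdist_lt/(_ (- f t)) := cf; rewrite oppr_gt0 => /(_ ft).
rewrite near_withinE => -[/= e e0 te].
have st0 : 0 < `|s - t| by rewrite normr_gt0 subr_eq0.
(* The bound 1/2 puts [u] strictly between [t] and [s]; the other bound puts it within [e / 2] of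
   [t]. *)
pose c := Num.min (1 / 2) (e / (2 * `|s - t|)).
have c0 : 0 < c by rewrite lt_min; apply/andP; split; [lra|rewrite divr_gt0// mulr_gt0].
have c1 : c <= 1 / 2 by rewrite ge_min lexx.
have ce : c * `|s - t| < e.
  have : c <= e / (2 * `|s - t|) by rewrite ge_min lexx orbT.
  rewrite ler_pdivlMr ?mulr_gt0//; lra.
pose u := t + c * (s - t).
have uitv : interior T u.
  rewrite /interior; have [lst|lts|] := ltgtP s t; last by move/eqP; rewrite (negbTE st).
  - have st' : 0 < t - s by rewrite subr_gt0.
    have cst := mulr_gt0 c0 st'.
    have c2st : 0 <= (1 / 2 - c) * (t - s) by rewrite mulr_ge0 ?subr_ge0// ltW.
    have su : s < u < t by rewrite /u; apply/andP; split; lra.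
    have : nbhs u `]s, t[%classic by apply: near_in_itvoo; rewrite in_itv.
    apply: filterS => v /=; rewrite in_itv/= => /andP[sv vt].
    by apply: (iT s t) => //; rewrite !ltW.
  - have st' : 0 < s - t by rewrite subr_gt0.
    have cst := mulr_gt0 c0 st'.
    have c2st : 0 <= (1 / 2 - c) * (s - t) by rewrite mulr_ge0 ?subr_ge0// ltW.
    have tu : t < u < s by rewrite /u; apply/andP; split; lra.
    have : nbhs u `]t, s[%classic by apply: near_in_itvoo; rewrite in_itv.
    apply: filterS => v /=; rewrite in_itv/= => /andP[sv vt].
    by apply: (iT t s) => //; rewrite !ltW.
have := te u; rewrite /ball_/= /u opprD addrA subrr add0r normrN normrM gtr0_norm// -/u.
move=> /(_ ce (nbhs_singleton uitv)); rewrite /from_subspace ltr_norml => /andP[fu _].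
by have := f0 _ uitv; lra.
Qed.

(** Positivity is given only on the interior, so endpoints need continuity. A nonconstant coordinate
    provides two distinct points of [T], hence one different from [t]. *)
Lemma decreasing_path_ge0 (T : set R) (x y : R -> R) : is_interval T ->
  decreasing_path T x y -> forall t, T t -> 0 <= x t /\ 0 <= y t.
Proof.
move=> iT [_ [_ [cx [cy [xy0 nc]]]]] t Tt.
have [s Ts st] : exists2 s, T s & s != t.
  have aux (f : R -> R) a b : T a -> T b -> f a != f b -> exists2 s, T s & s != t.
    move=> Ta Tb fab; have [at_|] := eqVneq a t; last by exists a.
    by exists b => //; rewrite -at_; apply: contra_neq fab => ->.
  by case: nc => -[a [b [Ta [Tb ab]]]]; exact: aux Ta Tb ab.
split; [apply: (interval_interior_gt0_ge0 iT Ts Tt st cx)|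
        apply: (interval_interior_gt0_ge0 iT Ts Tt st cy)];
  by move=> u /xy0[].
Qed.

Lemma rect_disjoint_l (s1 s2 t1 t2 s1' s2' t1' t2' : R) : t1 <= s1' ->
  rect s1 s2 t1 t2 `&` rect s1' s2' t1' t2' = set0.
Proof.
move=> ts; apply/seteqP; split => // -[u v] [[/=]] /andP[_ ut] _ [/=] /andP[su _] _.
by have := lt_le_trans su (le_trans ut ts); rewrite ltxx.
Qed.

Lemma rect_disjoint_r (s1 s2 t1 t2 s1' s2' t1' t2' : R) : t2 <= s2' ->
  rect s1 s2 t1 t2 `&` rect s1' s2' t1' t2' = set0.
Proof.
move=> ts; apply/seteqP; split => // -[u v] [[/=]] _ /andP[_ ut] [/=] _ /andP[su _].
by have := lt_le_trans su (le_trans ut ts); rewrite ltxx.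
Qed.

End Increments.

(** * Summation identities over the grid *)

Lemma sum_incr_grid (R : realType) (Om : Type) (d : nat)
    (X : R -> R -> Om -> 'rV[R]_d) (xx yy : nat -> R) (k n : nat) w : (k <= n)%N ->
  \sum_(0 <= a < k) \sum_(k <= l < n.+1) incr X (xx a) (yy l.+1) (xx a.+1) (yy l) w =
  incr X (xx 0%N) (yy n.+1) (xx k) (yy k) w.
Proof.
move=> kn.
(* For a fixed column [a] the sum over [l] telescopes in the second coordinate; what remains is a
   difference in [a], which telescopes in turn. *)
have inner a : \sum_(k <= l < n.+1) incr X (xx a) (yy l.+1) (xx a.+1) (yy l) w =
    (X (xx a.+1) (yy k) w - X (xx a.+1) (yy n.+1) w) -
    (X (xx a) (yy k) w - X (xx a) (yy n.+1) w).
  rewrite (@telescope_sumr_eq _ _ _ (fun l => X (xx a) (yy l) w - X (xx a.+1) (yy l) w)).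
  - by apply/rowP => i; rewrite !mxE; ring.
  - by rewrite ltnW.
  - by move=> l _; apply/rowP => i; rewrite !mxE; ring.
under eq_bigr do rewrite inner.
rewrite (telescope_sumr (fun a => X (xx a) (yy k) w - X (xx a) (yy n.+1) w))//.
by apply/rowP => i; rewrite !mxE; ring.
Qed.

(** Substitute [i = p.1 + 1] and [i + j = p.2 + 2]: for fixed [i] the range of [j] becomes
    [p.1 <= p.2 < n]. *)
Lemma sum_diagonals (V : zmodType) (n : nat) (F : nat -> nat -> V) :
  \sum_(1 <= i < n.+1) \sum_(1 <= j < (n - i).+2) F i (i + j)%N =
  \sum_(p : 'I_n * 'I_n) if (p.1 <= p.2)%N then F p.1.+1 p.2.+2 else 0.
Proof.
rewrite -(pair_bigA _ (fun a b : 'I_n => if (a <= b)%N then F a.+1 b.+2 else 0))/=.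
rewrite big_add1 big_mkord; apply: eq_bigr => a _.
rewrite -big_mkcond/= -(big_geq_mkord a n xpredT (fun b => F a.+1 b.+2)).
have := big_addn 0 n a xpredT (fun b => F a.+1 b.+2); rewrite add0n => ->.
rewrite big_add1/= subnSK//.
by apply: eq_bigr => j _; rewrite addSn addnS addnC.
Qed.

(** Both sides run over the triples a < k <= l <= n, on the right with [a = p.1] and [l = p.2 + 1];
    the inner sum there is empty when [p.2 < p.1]. *)
Lemma sum_triples (V : zmodType) (n : nat) (F : nat -> nat -> nat -> V) :
  \sum_(1 <= k < n.+1) \sum_(0 <= a < k) \sum_(k <= l < n.+1) F a l k =
  \sum_(p : 'I_n * 'I_n) \sum_(p.1.+1 <= k < p.2.+2) F p.1 p.2.+1 k.
Proof.
(* Padding with zeros makes all three ranges independent, so the sums exchange freely; here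
   [c = k - 1] and [b = l - 1]. *)
transitivity (\sum_(c < n) \sum_(a < n) \sum_(b < n)
    if (a <= c)%N && (c <= b)%N then F a b.+1 c.+1 else 0).
  rewrite big_add1 big_mkord; apply: eq_bigr => c _ /=.
  rewrite big_mkord (big_ord_widen n
    (fun a => \sum_(c.+1 <= l < n.+1) F a l c.+1))//= big_mkcond/=.
  apply: eq_bigr => a _; rewrite ltnS; case: leqP => _ /=; last by rewrite big1.
  by rewrite big_add1 big_geq_mkord -big_mkcond.
rewrite exchange_big/=.
rewrite -(pair_bigA _ (fun a b : 'I_n => \sum_(a.+1 <= k < b.+2) F a b.+1 k))/=.
apply: eq_bigr => a _; rewrite exchange_big/=; apply: eq_bigr => b _.
rewrite big_add1 big_geq_mkord (big_ord_widen_cond n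
  (fun i => (a <= i)%N) (fun c => F a b.+1 c.+1))//=.
by rewrite -big_mkcond.
Qed.

(** * The joint characteristic function along the path *)

Theorem theorem1 (R : realType) (dO : measure_display) (Om : measurableType dO)
  (P : probability Om R) (d : nat) (X : R -> R -> Om -> 'rV[R]_d)
  (psi_re psi_im : 'rV[R]_d -> R) (T : set R) (x y : R -> R) :
  two_param_levy P X -> levy_exponent P X psi_re psi_im ->
  is_interval T -> decreasing_path T x y ->
  forall (n : nat) (t : nat -> R), (1 <= n)%N ->
    (forall k, (1 <= k <= n)%N -> T (t k)) ->
    (forall k, (1 <= k < n)%N -> t k < t k.+1) ->
  let xx := fun k : nat => if k == 0%N then 0 else x (t k) in
  let yy := fun k : nat => if k == n.+1 then 0 else y (t k) in
  forall z : nat -> 'rV[R]_d,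
  let S := fun psi : 'rV[R]_d -> R =>
    \sum_(1 <= i < n.+1) \sum_(1 <= j < (n - i).+2)
      (xx i - xx i.-1) * (yy (i + j - 1)%N - yy (i + j)%N) *
      psi (\sum_(i <= k < i + j) z k) in
  let Y := fun w => \sum_(1 <= k < n.+1) dotv (z k) (X (x (t k)) (y (t k)) w) in
  (\int[P]_w (cos (Y w))%:E = (expR (S psi_re) * cos (S psi_im))%:E)%E /\
  (\int[P]_w (sin (Y w))%:E = (expR (S psi_re) * sin (S psi_im))%:E)%E.
Proof.
move=> [mX [indX [_ [axis _]]]] expX iT dp n t n1 tT tlt xx yy z S Y.
have ge0 := decreasing_path_ge0 iT dp.
have [xmono [ymono _]] := dp.
have tle i j : (1 <= i)%N -> (i <= j)%N -> (j <= n)%N -> t i <= t j.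
  move=> i1; elim: j => [|j IHj]; first by rewrite leqn0 => /eqP i0; rewrite i0 in i1.
  rewrite leq_eqVlt => /predU1P[->//|]; rewrite ltnS => ij jn.
  by apply: le_trans (IHj ij (ltnW jn)) _; rewrite ltW// tlt// (leq_trans i1 ij).
(* The values 0 at index 0 for [xx] and at [n.+1] for [yy] preserve monotonicity because the path is
   nonnegative. *)
have xxle i j : (i <= j)%N -> (j <= n)%N -> xx i <= xx j.
  rewrite /xx; case: i j => [|i] [|j]//= ij jn; first by case: (ge0 _ (tT j.+1 jn)).
  apply: xmono; rewrite ?inE; [|exact: tT|exact: tle].
  by apply: tT; exact: leq_trans ij jn.
have yyle i j : (1 <= i)%N -> (i <= j)%N -> (j <= n.+1)%N -> yy j <= yy i.
  rewrite /yy => i1 ij jn; case: (eqVneq i n.+1) => [i_n|i_n].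
    by have -> : j == n.+1 by rewrite eqn_leq jn -i_n.
  have i_le_n : (i <= n)%N by rewrite -ltnS ltn_neqAle i_n (leq_trans ij jn).
  have Ti : T (t i) by apply: tT; rewrite i1.
  case: (eqVneq j n.+1) => [_|j_n]; first by case: (ge0 _ Ti).
  have j_le_n : (j <= n)%N by rewrite -ltnS ltn_neqAle j_n jn.
  by apply: ymono; rewrite ?inE//; [apply: tT; rewrite j_le_n (leq_trans i1 ij)|exact: tle].
have xx0 : xx 0%N = 0 by [].
have yyn : yy n.+1 = 0 by rewrite /yy eqxx.
have xxge0 i : (i <= n)%N -> 0 <= xx i by move=> ?; rewrite -xx0 xxle.
have yyge0 i : (1 <= i)%N -> (i <= n.+1)%N -> 0 <= yy i by move=> ? ?; rewrite -yyn yyle.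
(* Indices are zero-based: [V p] is X(R_il) with [i = p.1 + 1] and [l = p.2 + 1]. *)
pose V (p : 'I_n * 'I_n) := incr X (xx p.1) (yy p.2.+2) (xx p.1.+1) (yy p.2.+1).
(* Rectangles with p.2 < p.1 carry the weight zeta p = 0; keeping them makes the
   index set a full square. *)
pose zeta (p : 'I_n * 'I_n) := \sum_(p.1.+1 <= k < p.2.+2) z k.
pose a (psi : 'rV[R]_d -> R) (p : 'I_n * 'I_n) := if (p.1 <= p.2)%N then
  (xx p.1.+1 - xx p.1) * (yy p.2.+1 - yy p.2.+2) * psi (zeta p) else 0.
have SE psi : S psi = \sum_p a psi p.
  rewrite /S (sum_diagonals n (fun i m => (xx i - xx i.-1) * (yy (m - 1)%N - yy m) *
    psi (\sum_(i <= k < m) z k))).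
  by apply: eq_bigr => p _; rewrite /a subn1.
have mdot u v (c : 'rV[R]_d) : measurable_fun setT (fun w => dotv c (X u v w)).
  move=> _ B mB; rewrite setTI; exact: mX (borel_rV_dotv c mB).
have mdotV (c : 'rV[R]_d) p : measurable_fun setT (fun w => dotv c (V p w)).
  rewrite /V /incr; under eq_fun do rewrite !dotvDr !dotvNr.
  by apply: measurable_funD => //; apply: measurable_funB => //; exact: measurable_funB.
have mY : measurable_fun setT Y by exact: measurable_sum.
(* Independence of increments is stated for families indexed by an ordinal, so the square is
   enumerated. *)
pose e : 'I_#|{: 'I_n * 'I_n}| -> 'I_n * 'I_n := enum_val.
have sum_e (F : 'I_n * 'I_n -> R) : \sum_i F (e i) = \sum_p F p.
  by rewrite [RHS](reindex e)//; apply: onW_bij; exact: enum_val_bij.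
have rect_ge0 (p : 'I_n * 'I_n) : 0 <= xx p.1 <= xx p.1.+1 /\ 0 <= yy p.2.+2 <= yy p.2.+1.
  have := ltn_ord p.1; have := ltn_ord p.2 => l2 l1.
  by split; apply/andP; split; [apply: xxge0|apply: xxle|apply: yyge0|apply: yyle]; lia.
have indepU (B : 'I_#|{: 'I_n * 'I_n}| -> set R) : (forall i, measurable (B i)) ->
    P (\bigcap_(i in setT) ((fun w => dotv (zeta (e i)) (V (e i) w)) @^-1` B i)) =
    (\prod_i P ((fun w => dotv (zeta (e i)) (V (e i) w)) @^-1` B i))%E.
  move=> mB.
  apply: (indX _ (fun i => xx (e i).1) (fun i => yy (e i).2.+2)
    (fun i => xx (e i).1.+1) (fun i => yy (e i).2.+1) _ _
    (fun i => dotv (zeta (e i)) @^-1` B i)) => [i|i j ij|i].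
  - exact: rect_ge0.
  - have : e i != e j by apply: contra_neq ij => /enum_val_inj.
    case: (e i) (e j) => [a1 b1] [a2 b2] /=; rewrite xpair_eqE negb_and => ab.
    (* Distinct cells differ in column or row. As [yy] decreases, the larger row index is the lower
       rectangle, which reverses the order of the cases. *)
    have [a12|a21|a12] := ltngtP a1 a2.
    + by apply: rect_disjoint_l; rewrite xxle// ltnW.
    + by rewrite setIC; apply: rect_disjoint_l; rewrite xxle// ltnW.
    have [b12|b21|b12] := ltngtP b1 b2.
    + by rewrite setIC; apply: rect_disjoint_r; rewrite yyle// ltnS ltnW.
    + by apply: rect_disjoint_r; rewrite yyle// ltnS ltnW.
    by move: ab; rewrite -!val_eqE/= a12 b12 !eqxx.
  - exact: borel_rV_dotv.
have charU p : \int[P]_w cos (dotv (zeta p) (V p w)) =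
      expR (a psi_re p) * cos (a psi_im p) /\
    \int[P]_w sin (dotv (zeta p) (V p w)) = expR (a psi_re p) * sin (a psi_im p).
  rewrite /a; case: leqP => [_|p21].
    have [hx hy] := rect_ge0 p; have [hc hs] := expX _ _ _ _ (zeta p) hx hy.
    by rewrite /Rintegral /V hc hs.
  have dot0 w : dotv (zeta p) (V p w) = 0.
    rewrite /zeta big_geq// /dotv; apply: big1 => i _; by rewrite mxE mul0r.
  under eq_Rintegral do rewrite dot0 cos0.
  under [X in _ /\ X = _]eq_Rintegral do rewrite dot0 sin0.
  rewrite !Rintegral_cst// expR0 cos0 sin0 !mul1r mul0r; split=> //.
  by have := congr1 fine (probability_setT P).
have [Uc Us] := charfun_sum (fun i => mdotV (zeta (e i)) (e i)) indepU
  (fun i => (charU (e i)).1) (fun i => (charU (e i)).2).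
pose Z w := \sum_i dotv (zeta (e i)) (V (e i) w).
have mZ : measurable_fun setT Z by apply: measurable_sum => i; exact: mdotV.
(* The equality is only almost sure: the grid sum gives the increment over the rectangle from the
   origin to (x_k, y_k), whose other three corners lie on the axes. *)
have YZ : {ae P, forall w, Y w = Z w}.
  apply: filterS axis => w X0.
  rewrite /Z (sum_e (fun p => dotv (zeta p) (V p w))) /zeta.
  under [RHS]eq_bigr do rewrite dotv_suml.
  rewrite -(sum_triples n (fun a l k => dotv (z k) (incr X (xx a) (yy l.+1) (xx a.+1) (yy l) w))).
  apply: eq_big_nat => k /andP[k1 kn].
  under eq_bigr do rewrite -dotv_sumr.
  rewrite -dotv_sumr sum_incr_grid// /incr xx0 yyn.
  have k0 := xxge0 k kn; have k0' := yyge0 k k1 (ltnW kn).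
  have [-> _] := X0 _ k0'; have [_ ->] := X0 _ k0; have [-> _] := X0 _ (lexx 0).
  (* As 1 <= k <= n, neither boundary convention applies at index [k]. *)
  by rewrite !subr0 addr0 /xx /yy gtn_eqF// ltn_eqF.
have swap (f : R -> R) : (forall g : Om -> R, measurable_fun setT g ->
     bounded_measurable (fun w => f (g w))) ->
    (\int[P]_w (f (Y w))%:E)%E = (\int[P]_w f (Z w))%:E.
  move=> bf; rewrite -EFin_Rintegral; last exact: bf.
  apply: ae_eq_integral => //.
  - by apply/measurable_EFinP; case: (bf _ mY).
  - by apply/measurable_EFinP; case: (bf _ mZ).
  - by apply: filterS YZ => w YZw _; rewrite /= YZw.
rewrite !swap; last 2 first.
- exact: bounded_measurable_sin.
- exact: bounded_measurable_cos.
by rewrite Uc Us !(sum_e (a _)) !SE.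
Qed.
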